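(* Let $\mathbb P$ be a partition, $P_0$ a probability on $\mathcal A(\mathbb P)$, and let $a\in\mathbb R$, $b>0$ satisfy $a+b>1$ and $b+2a\le 1$. Let $\mu:\mathcal A(\mathbb P)\to\mathbb R$ be NL$(a,b)$ with respect to $P_0$. Then $\mu$ is a 2-coherent lower probability, and its conjugate $\mu^c$ (given by $\mu^c(A)=1-\mu(\neg A)$, which is NL$(c,b)$ with $c=1-(a+b)$) is a 2-coherent upper probability.
   Context: A partition $\mathbb P$ is an arbitrary (finite or infinite) set of pairwise disjoint non-impossible events (atoms) whose logical sum is the sure event $\Omega$. $\mathcal A(\mathbb P)$ is the powerset of $\mathbb P$ (events are identified with sets of atoms); $\emptyset$ is the impossible event and $\neg A$ the complement of $A$. A probability on $\mathcal A(\mathbb P)$ is a finitely additive function $P_0:\mathcal A(\mathbb P)\to[0,1]$ with $P_0(\Omega)=1$ (no countable additivity is required). $I_A$ is the indicator of $A$. Given $P_0$, $a\in\mathbb R$ and $b>0$, $\mu:\mathcal A(\mathbb P)\to\mathbb R$ is NL$(a,b)$ if $\mu(\emptyset)=0$, $\mu(\Omega)=1$, and $\mu(A)=\min\{\max\{bP_0(A)+a,0\},1\}$ for all $A\in\mathcal A(\mathbb P)\setminus\{\emptyset,\Omega\}$. A lower probability $\underline P:\mathcal A(\mathbb P)\to\mathbb R$ is 2-coherent if, for all $s_1\ge 0$, $s_0\in\mathbb R$ and $A_0,A_1\in\mathcal A(\mathbb P)$, putting $\underline G_2=s_1(I_{A_1}-\underline P(A_1))-s_0(I_{A_0}-\underline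 P(A_0))$, one has $\max\underline G_2\ge 0$ (maximum over atoms). An upper probability $\overline P:\mathcal A(\mathbb P)\to\mathbb R$ is 2-coherent if its conjugate lower probability $A\mapsto 1-\overline P(\neg A)$ is 2-coherent. *)

(* Defs.v *)
(* MathComp-Analysis.  A partition is represented by the type T of its atoms
   (no finiteness or countability assumed), and an event by the set of atoms
   it contains: the powerset of the partition is set T, the impossible event
   set0, the sure event setT, and the complement of A is ~` A.  T is nonempty
   as soon as it carries a probability. *)
From HB Require Import structures.
From mathcomp Require Import all_boot all_order all_algebra.
From mathcomp Require Import classical_sets reals numfun.

Set Implicit Arguments.
Unset Strict Implicit.
Unset Printing Implicit Defensive.

Import Order.TTheory GRing.Theory Num.Theory.

Local Open Scope classical_set_scope.
Local Open Scope ring_scope.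

(* Only finitely additive, and real-valued on all subsets of T. *)
Record is_probability (R : realType) (T : Type) (P0 : set T -> R) : Prop :=
  IsProbability {
    probability_ge0 : forall A, 0 <= P0 A ;
    probability_le1 : forall A, P0 A <= 1 ;
    probability_additive : forall A B,
      A `&` B = set0 -> P0 (A `|` B) = P0 A + P0 B ;
    probability_sure : P0 setT = 1 }.

Record is_NL (R : realType) (T : Type) (P0 : set T -> R) (a b : R)
    (mu : set T -> R) : Prop := IsNL {
  NL_impossible : mu set0 = 0 ;
  NL_sure : mu setT = 1 ;
  NL_other : forall A, A <> set0 -> A <> setT ->
    mu A = Num.min (Num.max (b * P0 A + a) 0) 1 }.

Definition conjugate (R : realType) (T : Type) (mu : set T -> R) : set T -> R :=
  fun A => 1 - mu (~` A).

Definition gain2 (R : realType) (T : Type) (lP : set T -> R)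
    (s1 s0 : R) (A1 A0 : set T) : T -> R :=
  fun w => s1 * (\1_A1 w - lP A1) - s0 * (\1_A0 w - lP A0).

(* m is the (attained) maximum of f. *)
Definition is_max (R : realType) (T : Type) (f : T -> R) (m : R) : Prop :=
  range f m /\ ubound (range f) m.

Definition coherent2_lower (R : realType) (T : Type) (lP : set T -> R) : Prop :=
  forall (s1 s0 : R) (A0 A1 : set T), 0 <= s1 ->
    exists2 m, is_max (gain2 lP s1 s0 A1 A0) m & 0 <= m.

Definition coherent2_upper (R : realType) (T : Type) (uP : set T -> R) : Prop :=
  coherent2_lower (conjugate uP).

(* Main.v *)
Require Import Defs.
From mathcomp Require Import all_boot all_order all_algebra.
From mathcomp Require Import boolp classical_sets reals numfun.
From mathcomp Require Import lra.

Import Order.TTheory GRing.Theory Num.Theory.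

Local Open Scope classical_set_scope.
Local Open Scope ring_scope.

(** A gain built on two events is constant on each of the (at most four) cells
    they cut out, so its maximum is attained, and 2-coherence only asks for
    one atom at which the gain is nonnegative.  Such an atom can be found as
    soon as the lower probability is normalized, monotone and satisfies
    [lP A + lP (~` A) <= 1] ([coherent2_lower_of_monotone]).

    - If [0 <= s0], the bet is for [A1] and against [A0].  An atom of
      [A1 `\` A0] wins both parts.  Otherwise [A1 `<=` A0], so the price of
      [A1] is at most that of [A0]: an atom of [A1] gives a nonnegative gain if
      [s0 <= s1], and an atom outside [A0] does if [s1 <= s0] ([stake_tradeoff]).
    - If [s0 < 0], the bet is for both events.  An atom of [A1 `&` A0] wins
      both parts.  Otherwise the events are disjoint, hence
      [lP A1 <= 1 - lP A0], and the same comparison of stakes chooses between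
      an atom of [A1] and an atom of [A0].

    An NL measure is, off the impossible and sure events, the truncation to
    [[0, 1]] of an increasing affine function of [P0], so it is monotone.
    Truncation is monotone and commutes with [x |-> 1 - x] ([clamp_1B]).
    Hence it preserves the bound by 1 on the sum of the affine functions at
    [A] and [~` A], which is [b + 2 * a]; for the same reason the conjugate is
    again a truncated affine function of [P0].  Conjugating twice gives [mu]
    back, so the claim on the conjugate is the one on [mu]. *)

Lemma is_max_of_finite_factor {R : realType} {T : Type} {F : finType}
    (h : T -> F) (g : F -> R) (w0 : T) :
  exists2 m, is_max (fun w => g (h w)) m & g (h w0) <= m.
Proof.
pose attained : pred F := fun y => `[< range h y >].
have h0 : attained (h w0) by apply/asboolP; exists w0.
case: (@arg_maxP _ _ _ _ attained g h0) => y /asboolP[w _ <-] ymax.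
have le_max w' : g (h w') <= g (h w).
  by apply: ymax; apply/asboolP; exists w'.
exists (g (h w)); last exact: le_max.
by split; [exists w | move=> _ [w' _ <-]; exact: le_max].
Qed.

Lemma gain2_max {R : realType} {T : Type} (lP : set T -> R) (s1 s0 : R)
    (A1 A0 : set T) (w : T) :
  0 <= gain2 lP s1 s0 A1 A0 w ->
  exists2 m, is_max (gain2 lP s1 s0 A1 A0) m & 0 <= m.
Proof.
move=> gain_ge0.
have [m mmax gain_le] := is_max_of_finite_factor
  (fun w => (w \in A1, w \in A0))
  (fun u => s1 * (u.1%:R - lP A1) - s0 * (u.2%:R - lP A0)) w.
by exists m => //; exact: le_trans gain_le.
Qed.

(** Of two comparable prices [p <= q] and two stakes, the larger stake decides
    which of the two products dominates. *)
Lemma stake_tradeoff {R : realType} (s t p q : R) :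
  0 <= s -> 0 <= t -> 0 <= p -> p <= q -> q <= 1 ->
  t * (1 - q) <= s * (1 - p) \/ s * p <= t * q.
Proof.
move=> s_ge0 t_ge0 p_ge0 pq q_le1.
have [ts|/ltW st] := leP t s.
  by left; apply: ler_pM; rewrite ?subr_ge0// lerD2l lerN2.
by right; apply: ler_pM.
Qed.

(** The criterion through which every coherence claim goes.  Normalization
    settles the cells that are empty because an event is impossible or sure,
    and provides an atom to begin with. *)
Lemma coherent2_lower_of_monotone {R : realType} {T : Type} (lP : set T -> R) :
  lP set0 = 0 -> lP setT = 1 ->
  (forall A B, A `<=` B -> lP A <= lP B) ->
  (forall A, lP A + lP (~` A) <= 1) ->
  coherent2_lower lP.
Proof.
move=> lP0 lPT lP_mono lP_compl s1 s0 A0 A1 s1_ge0.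
have lP_ge0 A : 0 <= lP A by rewrite -lP0; apply: lP_mono.
have lP_le1 A : lP A <= 1 by rewrite -lPT; apply: lP_mono.
have [w0 _] : (setT : set T) !=set0.
  apply/set0P/eqP => T0; move: lPT; rewrite T0 lP0 => /esym/eqP.
  by rewrite oner_eq0.
suff [w] : exists w, 0 <= gain2 lP s1 s0 A1 A0 w by exact: gain2_max.
have win1 : 0 <= s1 * (1 - lP A1) by rewrite mulr_ge0 ?subr_ge0.
rewrite /gain2; have [s0_ge0|/ltW s0_le0] := leP 0 s0.
- have win0 : 0 <= s0 * lP A0 by rewrite mulr_ge0.
  have [A10|/existsNP[w /not_implyP[A1w A0w]]] := pselect (A1 `<=` A0); last first.
    by exists w; rewrite !indicE mem_set// memNset//=; lra.
  have [A1_0|/eqP/set0P[w1 A1w]] := pselect (A1 = set0).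
    have [->|/setTPn[w A0w]] := eqVneq A0 setT.
      by exists w0; rewrite A1_0 lP0 lPT !indicE in_set0 in_setT /=; lra.
    by exists w; rewrite A1_0 lP0 !indicE in_set0 memNset//=; lra.
  have [->|/setTPn[w2 A0w]] := eqVneq A0 setT.
    by exists w1; rewrite lPT !indicE in_setT mem_set//=; lra.
  have [h|h] := @stake_tradeoff _ s1 s0 (lP A1) (lP A0)
    s1_ge0 s0_ge0 (lP_ge0 _) (lP_mono _ _ A10) (lP_le1 _).
    by exists w1; rewrite !indicE !mem_set//=; [lra|exact: A10].
  by exists w2; rewrite !indicE !memNset//=; [lra|move=> /A10].
- have t_ge0 : 0 <= - s0 by rewrite oppr_ge0.
  have win0 : 0 <= - s0 * (1 - lP A0) by rewrite mulr_ge0 ?subr_ge0.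
  have [[w [A1w A0w]]|A10] := pselect (exists w, A1 w /\ A0 w).
    by exists w; rewrite !indicE !mem_set//=; lra.
  have [A1_0|/eqP/set0P[w1 A1w]] := pselect (A1 = set0).
    have [->|/set0P[w A0w]] := eqVneq A0 set0.
      by exists w0; rewrite A1_0 lP0 !indicE in_set0 /=; lra.
    by exists w; rewrite A1_0 lP0 !indicE in_set0 mem_set//=; lra.
  have A0w1 : ~ A0 w1 by move=> A0w; apply: A10; exists w1.
  have [A0_0|/set0P[w2 A0w]] := eqVneq A0 set0.
    by exists w1; rewrite A0_0 lP0 !indicE in_set0 mem_set//=; lra.
  have A1w2 : ~ A1 w2 by move=> A1w2; apply: A10; exists w2.
  have p10 : lP A1 <= 1 - lP A0.
    rewrite lerBrDr; apply: le_trans (lP_compl A1); rewrite lerD2l.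
    by apply: lP_mono => w A0w' A1w'; apply: A10; exists w.
  (* Betting for [A0] at price [lP A0] is betting against its complement at
     price [1 - lP A0]. *)
  have [h|h] := @stake_tradeoff _ s1 (- s0) (lP A1) (1 - lP A0)
    s1_ge0 t_ge0 (lP_ge0 _) p10 ltac:(by rewrite gerBl).
    by exists w1; rewrite !indicE mem_set// memNset//=; lra.
  by exists w2; rewrite !indicE memNset// mem_set//=; lra.
Qed.

Lemma clamp_ge0 {R : realType} (x : R) : 0 <= Num.min (Num.max x 0) 1.
Proof. by rewrite le_min le_max lexx orbT ler01. Qed.

Lemma clamp_le1 {R : realType} (x : R) : Num.min (Num.max x 0) 1 <= 1.
Proof. by rewrite ge_min lexx orbT. Qed.

Lemma clamp_le {R : realType} (x y : R) : x <= y ->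
  Num.min (Num.max x 0) 1 <= Num.min (Num.max y 0) 1.
Proof.
by move=> xy; rewrite le_min !ge_min lexx orbT andbT ge_max !le_max xy lexx !orbT.
Qed.

Lemma clamp_1B {R : realType} (x : R) :
  Num.min (Num.max (1 - x) 0) 1 = 1 - Num.min (Num.max x 0) 1.
Proof.
rewrite minEle [in RHS]minEle ge_max ler01 andbT ge_max ler01 andbT.
by case: (leP x 0) => ?; case: (leP (1 - x) 0) => ?;
  case: (leP x 1) => ?; case: (leP (1 - x) 1) => ?; lra.
Qed.

Lemma clamp_add_le1 {R : realType} (x y : R) : x + y <= 1 ->
  Num.min (Num.max x 0) 1 + Num.min (Num.max y 0) 1 <= 1.
Proof.
by move=> xy; rewrite -lerBrDl -clamp_1B; apply: clamp_le; lra.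
Qed.

Section NL.
Context {R : realType} {T : Type} {P0 : set T -> R} {a b : R} {mu : set T -> R}.
Hypotheses (hP0 : is_probability P0) (hmu : is_NL P0 a b mu).

Lemma probability_le (A B : set T) : A `<=` B -> P0 A <= P0 B.
Proof.
move=> AB; rewrite -(setDUK AB) (probability_additive hP0) ?setDIK//.
by rewrite lerDl (probability_ge0 hP0).
Qed.

Lemma probability_setC (A : set T) : P0 (~` A) = 1 - P0 A.
Proof.
have := probability_additive hP0 (setICr A).
by rewrite setUv (probability_sure hP0) => ->; rewrite addrC addKr.
Qed.

Lemma NL_ge0 (A : set T) : 0 <= mu A.
Proof.
have [->|/eqP A0] := eqVneq A set0; first by rewrite (NL_impossible hmu).
have [->|/eqP AT] := eqVneq A setT; first by rewrite (NL_sure hmu).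
by rewrite (NL_other hmu)// clamp_ge0.
Qed.

Lemma NL_le1 (A : set T) : mu A <= 1.
Proof.
have [->|/eqP A0] := eqVneq A set0; first by rewrite (NL_impossible hmu).
have [->|/eqP AT] := eqVneq A setT; first by rewrite (NL_sure hmu).
by rewrite (NL_other hmu)// clamp_le1.
Qed.

Lemma NL_le (A B : set T) : 0 <= b -> A `<=` B -> mu A <= mu B.
Proof.
move=> b_ge0 AB.
have [->|/eqP A0] := eqVneq A set0; first by rewrite (NL_impossible hmu) NL_ge0.
have [->|/eqP BT] := eqVneq B setT; first by rewrite (NL_sure hmu) NL_le1.
have AT : A <> setT by move=> AT; apply: BT; rewrite -subTset -AT.
have B0 : B <> set0 by move=> B0; apply: A0; rewrite -subset0 -B0.
rewrite !(NL_other hmu)//; apply: clamp_le; rewrite lerD2r.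
by rewrite ler_wpM2l// probability_le.
Qed.

Lemma NL_add_setC_le1 (A : set T) : b + 2 * a <= 1 -> mu A + mu (~` A) <= 1.
Proof.
move=> hb2a.
have [->|/eqP A0] := eqVneq A set0.
  by rewrite setC0 (NL_impossible hmu) (NL_sure hmu) add0r.
have [->|/eqP AT] := eqVneq A setT.
  by rewrite setCT (NL_impossible hmu) (NL_sure hmu) addr0.
have CA0 : ~` A <> set0 by move=> /(congr1 setC); rewrite setCK setC0.
have CAT : ~` A <> setT by move=> /(congr1 setC); rewrite setCK setCT.
rewrite !(NL_other hmu)//; apply: clamp_add_le1; rewrite probability_setC.
by lra.
Qed.

Lemma conjugate_NL : is_NL P0 (1 - (a + b)) b (conjugate mu).
Proof.
split; rewrite /conjugate.
- by rewrite setC0 (NL_sure hmu) subrr.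
- by rewrite setCT (NL_impossible hmu) subr0.
move=> A A0 AT.
have CA0 : ~` A <> set0 by move=> /(congr1 setC); rewrite setCK setC0.
have CAT : ~` A <> setT by move=> /(congr1 setC); rewrite setCK setCT.
rewrite (NL_other hmu)// -clamp_1B probability_setC.
by congr (Num.min (Num.max _ _) _); lra.
Qed.

End NL.

Lemma conjugateK {R : realType} {T : Type} (mu : set T -> R) :
  conjugate (conjugate mu) = mu.
Proof. by apply/funext => A; rewrite /conjugate setCK subKr. Qed.

Theorem proposition5p1 (R : realType) (T : Type) (P0 : set T -> R) (a b : R)
    (mu : set T -> R)
    (hP0 : is_probability P0)
    (hb : 0 < b)
    (hab : a + b > 1)
    (hb2a : b + 2 * a <= 1)
    (hmu : is_NL P0 a b mu) :
  [/\ coherent2_lower mu,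
      is_NL P0 (1 - (a + b)) b (conjugate mu)
    & coherent2_upper (conjugate mu)].
Proof.
have mu_coherent : coherent2_lower mu.
  apply: coherent2_lower_of_monotone.
  - exact: NL_impossible hmu.
  - exact: NL_sure hmu.
  - by move=> A B; apply: NL_le hP0 hmu _ _ (ltW hb).
  - by move=> A; exact: (NL_add_setC_le1 hP0 hmu).
split => //; first exact: (conjugate_NL hP0 hmu).
by rewrite /coherent2_upper conjugateK.
Qed.
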